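(* Let $G$ be a cop-win graph on $n\ge 11$ vertices. Then $G$ has capture time $n-5$ if and only if one of the following holds: (1) $G$ 1-realizes a standard extension of $(1,4,2,1)$; (2) $G$ 1-realizes a vector obtained from a standard extension of $(2,2,2,1)$ by adding 1 to exactly one entry; (3) $G$ 0-realizes a standard extension of $(3,3,2,1)$.
   Context: All graphs are finite, nonempty, and reflexive (every vertex has a loop, so each vertex is adjacent to itself). $N[v]$ denotes the closed neighborhood of $v$ (including $v$). For distinct vertices $v,w$, $w$ strictly corners $v$ if $N[v]\subsetneq N[w]$; $v$ is then a strict corner. A vertex dominates a set if it is adjacent to every vertex of it. Cops and robbers: a cop chooses a vertex, then the robber; then they alternate moves, cop first, each move to an adjacent vertex or staying. The cop wins upon occupying the robber's vertex. $G$ is cop-win if the cop can force a win; the capture time of a cop-win graph is the minimum number of cop moves (not counting her initial placement) needed to guarantee capture. Corner ranking: set $G^{(1)}=G$, $k=1$. If $G^{(k)}$ is a clique, give all its vertices rank $k$ and stop. Else if $G^{(k)}$ has no strict corners, give all its vertices rank $\infty$ and stop. Else give every strict corner of $G^{(k)}$ rank $k$, delete them to obtain $G^{(k+1)}$ (induced subgraph), increase $k$ and repeat. The corner rank of $G$ is the largest rank of a vertex; $X_k$ is the set of rank-$k$ vertices. If $G$ has finite corner rank $\alpha\ge 2$, $G$ is of type 1 if some (equivalently every) vertex of rank $\alpha$ dominates $V(G^{(\alpha-1)})$, and of type 0 otherwise. (Known: $G$ is cop-win iff its corner rank is finite, and then a type-$r$ graph has capture time $\alpha-r$.) A vector is a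 finite list of positive integers. The rank cardinality vector of $G$ of corner rank $\alpha$ is $(x_\alpha,\dots,x_1)$ with $x_k=|X_k|$. $G$ $r$-realizes a vector ($r\in\{0,1\}$) if $G$ is cop-win of type $r$ and the vector is its rank cardinality vector. A standard extension of $(x_\alpha,\dots,x_1)$ is any vector $(x_\alpha,\dots,x_1,x_1,\dots,x_1)$ obtained by appending zero or more copies of the last entry $x_1$. *)

(* Defs.v *)
(* A reflexive graph is a finType T with a reflexive,
   symmetric relation adj : rel T (adj v v holds for every v). *)
From mathcomp Require Import all_boot.
Set Implicit Arguments. Unset Strict Implicit. Unset Printing Implicit Defensive.

Section CopsRobbers.
Variables (T : finType) (adj : rel T).

Definition nbhd (S : {set T}) (v : T) : {set T} := [set u in S | adj v u].

Definition is_clique (S : {set T}) : bool :=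
  [forall u in S, forall v in S, adj u v].

Definition strict_corners (S : {set T}) : {set T} :=
  [set v in S | [exists w in S, (w != v) && (nbhd S v \proper nbhd S w)]].

(** one step of the corner ranking; once a clique is reached the
    process stops (all remaining vertices are ranked), modelled by set0 *)
Definition rank_step (S : {set T}) : {set T} :=
  if is_clique S then set0 else S :\: strict_corners S.

Fixpoint Gseq (k : nat) : {set T} :=
  if k is k'.+1 then rank_step (Gseq k') else setT.

Definition Gk (k : nat) : {set T} := Gseq k.-1.

(** X_k, the set of vertices of rank k (k >= 1, finite rank) *)
Definition Xk (k : nat) : {set T} :=
  if is_clique (Gk k) then Gk k else strict_corners (Gk k).

Definition corner_rank (alpha : nat) : Prop :=
  1 <= alpha /\ is_clique (Gk alpha) /\
  (forall k, 1 <= k < alpha -> ~~ is_clique (Gk k) /\ strict_corners (Gk k) != set0).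

Definition dominates (v : T) (S : {set T}) : bool := [forall u in S, adj v u].

Definition rank_card_vector (alpha : nat) : seq nat :=
  [seq #|Xk k| | k <- rev (iota 1 alpha)].

(** Cops and robbers.  [cop_wins_in k c r]: cop at c, robber at r, cop to
    move; the cop can guarantee capture within at most k further cop moves. *)
Fixpoint cop_wins_in (k : nat) (c r : T) : bool :=
  if k is k'.+1 then
    (c == r) || [exists c', adj c c' &&
                   ((c' == r) || [forall r', adj r r' ==> cop_wins_in k' c' r'])]
  else c == r.

Definition cop_wins_within (t : nat) : Prop :=
  exists c0 : T, forall r0 : T, cop_wins_in t c0 r0.

Definition cop_win : Prop := exists t, cop_wins_within t.

Definition capture_time (t : nat) : Prop :=
  cop_wins_within t /\ forall t', t' < t -> ~ cop_wins_within t'.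

Definition realizes (r : nat) (vec : seq nat) : Prop :=
  cop_win /\ (r <= 1) /\
  exists alpha, [/\ corner_rank alpha, 2 <= alpha,
     (r == 1) = [exists v in Xk alpha, dominates v (Gk alpha.-1)] &
     rank_card_vector alpha = vec].

End CopsRobbers.

Definition std_ext (s : seq nat) (m : nat) : seq nat := s ++ nseq m (last 0 s).

Definition incr_entry (s : seq nat) (i : nat) : seq nat := set_nth 0 s i (nth 0 s i).+1.

(* Main.v *)
(* Write X(S) for the strict corners of S and core(S) = S \ X(S), so that the
   ranking is G, core(G), core(core(G)), ...

   Retracting each level on the next one sends a vertex to its shadows. A cop on
   (or next to) the shadow of the robber at level k reaches the one at level k - 1
   at the next move, and a robber outside the neighbourhood of the cop's shadow can
   keep away one level lower; hence the capture time of a graph of type r and corner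
   rank a is a - r, and the capture time is n - 5 iff the cardinalities x_k exceed 1
   by a total of 4 (type 1) or 5 (type 0).

   A vertex v that becomes a strict corner of core(S), cornered by w, has a neighbour
   in X(S) that is not adjacent to w. Hence if X(S) is a single vertex, then X(core S)
   is dominated by some d in core(core S), and such a d corners nothing in
   core(core S). This is impossible on the two levels below the clique, and on the
   following ones as soon as the levels above contain few vertices: either they
   produce two corners with distinct unique neighbours, a situation that persists
   downwards, or a short case analysis applies. What is left is arithmetic; a corner
   rank of at least 6, i.e. n >= 11, leaves room for the excluded first 1. *)
Require Import Defs.
From mathcomp Require Import all_boot zify.
Set Implicit Arguments. Unset Strict Implicit. Unset Printing Implicit Defensive.

(** * Strict corners and the core of a vertex set *)

Section Corners.
Variables (T : finType) (adj : rel T).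
Hypotheses (adj_refl : reflexive adj) (adj_sym : symmetric adj).
Implicit Types (S : {set T}) (u v w y z : T).
Local Notation X := (strict_corners adj).

Definition core S := S :\: X S.

(** Read as [v] cornered by [w]. The last clause already forces [v] and [w] to be distinct. *)
Definition corners S v w : Prop :=
  [/\ v \in S, w \in S, forall y, y \in S -> adj v y -> adj w y
    & exists y, [/\ y \in S, adj w y & ~~ adj v y]].

Lemma core_sub S v : v \in core S -> v \in S.
Proof. by rewrite inE => /andP[]. Qed.

Lemma strict_corners_sub S v : v \in X S -> v \in S.
Proof. by rewrite inE => /andP[]. Qed.

Lemma core_cornerF S v : v \in core S -> v \in X S -> False.
Proof. by rewrite inE => /andP[/negP]. Qed.

Lemma in_core_or_corner S v : v \in S -> v \in core S \/ v \in X S.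
Proof. by rewrite [v \in core S]inE => ->; case: (v \in X S); [right | left]. Qed.

Lemma nbhd_properP S v w : v \in S -> w \in S ->
  reflect (corners S v w) (nbhd adj S v \proper nbhd adj S w).
Proof.
move=> vS wS; apply: (iffP properP) => [[/subsetP sub [y]]|[_ _ sub [y [yS wy vy]]]].
  rewrite !inE => /andP[yS wy]; rewrite yS => /= vy; split=> //; last by exists y.
  by move=> t tS vt; have := sub t; rewrite !inE tS; apply.
split; last by exists y; rewrite !inE yS.
by apply/subsetP=> t; rewrite !inE => /andP[tS vt]; rewrite tS sub.
Qed.

Lemma strict_cornersP S v : reflect (exists w, corners S v w) (v \in X S).
Proof.
rewrite inE; apply: (iffP andP).
  by case=> vS /existsP[w /and3P[wS _ /(nbhd_properP vS wS) vw]]; exists w.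
case=> w [vS wS sub [y [yS wy vy]]]; split=> //; apply/existsP; exists w.
rewrite wS /=; apply/andP; split; first by apply: contraNneq vy => <-.
by apply/(nbhd_properP vS wS); split=> //; exists y.
Qed.

Lemma corners_strict S v w : corners S v w -> v \in X S.
Proof. by move=> vw; apply/strict_cornersP; exists w. Qed.

Lemma corners_adj S v w : corners S v w -> adj w v.
Proof. by case=> vS _ sub _; apply: sub. Qed.

(** Among the vertices cornering [v] take one with the largest neighbourhood: anything cornering it
    would also corner [v], with a larger neighbourhood. *)
Lemma corners_core S v : v \in X S -> exists2 w, w \in core S & corners S v w.
Proof.
move=> /strict_cornersP[w0 vw0].
have vS : v \in S by case: vw0.
pose P := [pred w in S | nbhd adj S v \proper nbhd adj S w].
have P0 : P w0.
  by rewrite /P /=; case: (vw0) => _ wS _ _; rewrite wS; apply/(nbhd_properP vS wS).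
case: (@arg_maxnP _ w0 P (fun w => #|nbhd adj S w|) P0) => w /andP[wS vw] wmax.
exists w; last exact/(nbhd_properP vS wS).
rewrite inE wS andbT; apply/negP=> /strict_cornersP[t wt].
have tS : t \in S by case: wt.
have pwt : nbhd adj S w \proper nbhd adj S t by apply/(nbhd_properP wS tS).
have := wmax t; rewrite /P /= tS (proper_trans vw pwt) => /(_ isT) /=.
by rewrite leqNgt proper_card.
Qed.

Lemma strict_corner_nonadj S v : v \in X S -> exists2 y, y \in S & ~~ adj v y.
Proof. by case/strict_cornersP=> w [_ _ _ [y [yS _ vy]]]; exists y. Qed.

(* [v] is a strict corner of [core S] only, so deleting the corners of [S] must
   have removed a private neighbour of [v]. *)
Lemma corners_private S v w :
  corners (core S) v w -> exists u, [/\ u \in X S, adj v u & ~~ adj w u].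
Proof.
case=> vC wC sub [y [yC wy vy]].
case: (pickP [pred u in X S | adj v u && ~~ adj w u]) => [u /and3P[]|no].
  by exists u.
exfalso; apply: (core_cornerF vC); apply/strict_cornersP; exists w.
split; try exact: core_sub; last by exists y; split=> //; apply: core_sub.
move=> t tS vt; case: (in_core_or_corner tS) => [tC|tX]; first exact: sub.
by have := no t; rewrite inE /= tX vt /= => /negbFE.
Qed.

Lemma is_cliqueP S : reflect {in S &, forall u v, adj u v} (is_clique adj S).
Proof.
apply: (iffP forall_inP) => [cl u v uS vS|cl u uS].
  by move/forall_inP: (cl u uS); apply.
by apply/forall_inP=> v vS; apply: cl.
Qed.

Lemma dominatesP S v : reflect {in S, forall u, adj v u} (dominates adj v S).
Proof. exact: forall_inP. Qed.

Lemma dominates_core S v : v \in S -> dominates adj v S -> v \in core S.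
Proof.
move=> vS /dominatesP dom; case: (in_core_or_corner vS) => // /strict_corner_nonadj.
by case=> y yS; rewrite dom.
Qed.

Lemma core_dominates S d v :
  d \in S -> dominates adj d S -> v \in core S -> dominates adj v S.
Proof.
move=> dS /dominatesP dom vC; apply/dominatesP => u uS; apply/negPn/negP => nvu.
apply: (core_cornerF vC); apply/strict_cornersP; exists d.
split=> //; [exact: core_sub|by move=> y yS _; apply: dom|by exists u; split=> //; apply: dom].
Qed.

Lemma clique_core S d : d \in S -> dominates adj d S -> is_clique adj (core S).
Proof.
move=> dS dom; apply/is_cliqueP=> u v uC vC.
by move/dominatesP: (core_dominates dS dom uC); apply; apply: core_sub.
Qed.

(** ** Capture time *)

(** A retraction of [S] on its core. For [v] in [S] the default of [odflt] is never reached, by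
    [corners_core]. *)
Definition shadow_step S v :=
  if v \in X S then odflt v [pick w in core S | nbhd adj S v \proper nbhd adj S w]
  else v.

Lemma shadow_stepP S v : v \in S ->
  shadow_step S v \in core S /\
  forall y, y \in S -> adj v y -> adj (shadow_step S v) y.
Proof.
move=> vS; rewrite /shadow_step; case: ifP => [vX|/negbT vX].
  case: pickP => [w /andP[wC vw]|no] /=.
    by split=> //; case/(nbhd_properP vS (core_sub wC)): vw.
  case/corners_core: vX => w wC vw; have /= := no w; rewrite wC.
  by move/nbhd_properP: vw => ->//; apply: core_sub.
by split=> //; rewrite inE vX.
Qed.

Lemma shadow_step_id S v : v \in core S -> shadow_step S v = v.
Proof. by rewrite inE /shadow_step => /andP[/negbTE->]. Qed.

Local Notation G := (Gseq adj).

Fixpoint shadow j r := if j is j'.+1 then shadow_step (G j') (shadow j' r) else r.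

(** Past a clique [Gseq] is empty; this makes the first [j] steps genuine passages to the core.
    Levels count from 0: [G j] is what [j] deletions leave. *)
Definition proper_upto j := forall i, i < j -> ~~ is_clique adj (G i).

Lemma GseqS j : ~~ is_clique adj (G j) -> G j.+1 = core (G j).
Proof. by rewrite /= /rank_step => /negbTE->. Qed.

Lemma proper_uptoW j : proper_upto j.+1 -> proper_upto j.
Proof. by move=> pj i ij; apply: pj; apply: ltnW. Qed.

Lemma shadow_in j r : proper_upto j -> shadow j r \in G j.
Proof.
elim: j => [|j IH] pj; first by rewrite inE.
by rewrite GseqS ?pj //=; case: (shadow_stepP (IH (proper_uptoW pj))).
Qed.

Lemma shadow_dom j r y : proper_upto j ->
  y \in G j -> adj (shadow j r) y -> adj (shadow j.+1 r) y.
Proof. by move=> pj; case: (shadow_stepP (shadow_in r pj)) => _; apply. Qed.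

Lemma Gseq_sub j v : v \in G j.+1 -> v \in G j.
Proof. by rewrite /= /rank_step; case: ifP => _; rewrite ?inE // => /andP[]. Qed.

Lemma shadow_hom j r r' :
  proper_upto j -> adj r r' -> adj (shadow j r) (shadow j r').
Proof.
move=> + rr'; elim: j => [|j IH] pj //.
have pj' := proper_uptoW pj.
have h : adj (shadow j.+1 r) (shadow j r').
  by apply: shadow_dom => //; [apply: shadow_in | apply: IH].
rewrite adj_sym; apply: shadow_dom => //; last by rewrite adj_sym.
by apply: Gseq_sub; apply: shadow_in.
Qed.

Lemma shadow_id j r : proper_upto j -> r \in G j -> shadow j r = r.
Proof.
elim: j => [|j IH] pj // rG.
rewrite /= IH ?shadow_step_id -?GseqS ?pj //; first exact: proper_uptoW.
exact: Gseq_sub.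
Qed.

(** The cop moves onto the robber's shadow. Being the retraction of the shadow one level lower, her
    position is adjacent to that lower shadow even after the robber's answer, so each move gains a
    level. *)
Lemma cop_wins_shadow j c r :
  proper_upto j -> adj c (shadow j r) -> cop_wins_in adj j.+1 c r.
Proof.
elim: j c r => [|j IH] c r pj cr.
  by apply/orP; right; apply/existsP; exists r; rewrite eqxx andbT.
apply/orP; right; apply/existsP; exists (shadow j.+1 r); rewrite cr /=.
apply/orP; right; apply/forallP=> r'; apply/implyP=> rr'.
have pj' := proper_uptoW pj.
by apply: IH => //; apply: shadow_dom => //; [apply: shadow_in | apply: shadow_hom].
Qed.

(** Otherwise [d] would be adjacent to all neighbours of [r] in [S], and [e] would witness that [d]
    corners [r]. In use, [d] is the cop's new shadow and [e] a shadow of her old position. *)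
Lemma escape S d e r : r \in S -> r \notin X S -> d \in S -> e \in S ->
  adj e d -> ~~ adj e r -> exists r', [/\ r' \in S, adj r r' & ~~ adj d r'].
Proof.
move=> rS rX dS eS ed er.
case: (pickP [pred t in S | adj r t && ~~ adj d t]) => [t /and3P[]|no].
  by exists t.
case/strict_cornersP: rX; exists d; split=> // [y yS ry|].
  by have := no y; rewrite inE /= yS ry => /negbFE.
by exists e; split; rewrite // adj_sym.
Qed.

(** The robber gives up one level per cop move: a robber in [G j.+1] is not a strict corner of
    [G j], so [escape] keeps him away from the cop's shadow in [G j]. *)
Lemma robber_survives j c r :
  proper_upto j -> r \in G j -> ~~ adj (shadow j c) r -> ~~ cop_wins_in adj j.+1 c r.
Proof.
elim: j c r => [|j IH] c r pj rG ncr.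
  apply/negP => /orP[/eqP ecr|/existsP[c' /andP[cc' /orP[/eqP ecr|/forallP/(_ r)]]]].
  - by rewrite ecr adj_refl in ncr.
  - by rewrite -ecr cc' in ncr.
  - by rewrite adj_refl => /= /eqP ecr; rewrite -ecr cc' in ncr.
have pj' := proper_uptoW pj; have nc := pj j (ltnSn j).
have step c' : adj c c' -> adj (shadow j.+1 c) (shadow j c').
  by move=> cc'; apply: shadow_dom => //; [apply: shadow_in | apply: shadow_hom].
have nr c' : adj c c' -> c' <> r.
  move=> /step + ec'; rewrite ec' (shadow_id pj'); last exact: Gseq_sub.
  exact/negP.
apply/negP => /orP[/eqP|/existsP[c' /andP[cc' /orP[/eqP|/forallP nw]]]].
- exact: nr.
- exact: nr.
have rC : r \in core (G j) by rewrite -GseqS.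
case: (@escape (G j) (shadow j c') (shadow j.+1 c) r) => //.
- exact: core_sub.
- by apply/negP => /(core_cornerF rC).
- exact: shadow_in.
- by apply: Gseq_sub; apply: shadow_in.
- exact: step.
by move=> r' [r'G rr' nr']; have := nw r'; rewrite rr' implyTb; apply/negP; apply: IH.
Qed.

(* Against a stuck subgraph the robber keeps away from the cop's shadow forever. *)
Lemma robber_survives_stuck j : proper_upto j -> X (G j) = set0 ->
  forall t c r, r \in G j -> ~~ adj (shadow j c) r -> ~~ cop_wins_in adj t c r.
Proof.
move=> pj X0; elim=> [|t IH] c r rG ncr.
  by apply: contra ncr => /eqP->; rewrite shadow_id.
have nr c' : adj c c' -> c' <> r.
  by move=> cc' ec'; move: ncr; rewrite -(shadow_id pj rG) -ec' shadow_hom.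
apply/negP => /orP[/eqP|/existsP[c' /andP[cc' /orP[/eqP|/forallP nw]]]].
- exact: nr.
- exact: nr.
case: (@escape (G j) (shadow j c') (shadow j c) r) => //.
- by rewrite X0 inE.
- exact: shadow_in.
- exact: shadow_in.
- exact: shadow_hom.
by move=> r' [r'G rr' nr']; have := nw r'; rewrite rr' implyTb; apply/negP; apply: IH.
Qed.

Lemma not_wins_within j t :
  (forall d, d \in G j -> ~~ dominates adj d (G j)) ->
  (forall c r, r \in G j -> ~~ adj (shadow j c) r -> ~~ cop_wins_in adj t c r) ->
  proper_upto j -> ~ cop_wins_within adj t.
Proof.
move=> nd rob pj [c0 wins].
have /forall_inPn[r rG ncr] := nd _ (shadow_in c0 pj).
by have := rob c0 r rG ncr; rewrite wins.
Qed.

Lemma cop_wins_inS k c r : cop_wins_in adj k c r -> cop_wins_in adj k.+1 c r.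
Proof.
elim: k c r => [|k IH] c r; first by move=> /= ->.
case/orP => [cr|/existsP[c' /andP[cc' H]]]; first by apply/orP; left.
apply/orP; right; apply/existsP; exists c'; rewrite cc' /=.
case/orP: H => [->//|/forallP H]; apply/orP; right.
by apply/forallP=> r'; apply/implyP=> rr'; apply: IH; have := H r'; rewrite rr'.
Qed.

Lemma cop_wins_within_mono k l :
  k <= l -> cop_wins_within adj k -> cop_wins_within adj l.
Proof.
move=> /subnKC <-; elim: (l - k) => [|m IH] w; first by rewrite addn0.
by rewrite addnS; case: (IH w) => c0 H; exists c0 => r; apply: cop_wins_inS.
Qed.

Lemma capture_time_uniq s t : capture_time adj s -> capture_time adj t -> s = t.
Proof.
move=> [ws ms] [wt mt]; case: (ltngtP s t) => // lt.
  by case: (mt s).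
by case: (ms t).
Qed.

Lemma capture_timeI t :
  cop_wins_within adj t.+1 -> ~ cop_wins_within adj t -> capture_time adj t.+1.
Proof.
by move=> w n; split=> // s st ws; apply: n; apply: cop_wins_within_mono ws.
Qed.

Lemma Gseq_neq0 j v0 : proper_upto j -> exists v, v \in G j.
Proof. by move=> pj; exists (shadow j v0); apply: shadow_in. Qed.

Lemma dominator_clique j d : d \in G j -> dominates adj d (G j) ->
  ~~ is_clique adj (G j) -> is_clique adj (G j.+1).
Proof. by move=> dG dom nc; rewrite GseqS //; apply: clique_core dom. Qed.

Lemma corner_rank_proper alpha : corner_rank adj alpha -> proper_upto alpha.-1.
Proof.
by case=> a0 [_ H] i ia; have [] := H i.+1; rewrite // ltnS /=; case: alpha a0 ia {H}.
Qed.

Lemma Xk_top alpha : corner_rank adj alpha -> Xk adj alpha = Gk adj alpha.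
Proof. by case=> _ [cl _]; rewrite /Xk cl. Qed.

Lemma corner_rank_wins_within alpha (v0 : T) :
  corner_rank adj alpha -> cop_wins_within adj alpha.
Proof.
move=> cr; have := corner_rank_proper cr; case: cr => + [+ _]; rewrite /Gk.
case: alpha => //= a _ /is_cliqueP cl pa; have [v vG] := Gseq_neq0 v0 pa.
by exists v => r; apply: cop_wins_shadow => //; apply: cl => //; apply: shadow_in.
Qed.

(** The subtracted boolean is the type. A top vertex dominating the level before saves the cop a
    move. The lower bounds need a level without dominating vertex: two steps before the clique in
    type 1, since a dominator would make the next level a clique, and one step before it in type
    0. *)
Lemma capture_time_rank alpha (v0 : T) : corner_rank adj alpha -> 3 <= alpha ->
  capture_time adj
    (alpha - [exists v in Xk adj alpha, dominates adj v (Gk adj alpha.-1)]).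
Proof.
move=> cr; have := corner_rank_wins_within v0 cr.
have := corner_rank_proper cr; rewrite (Xk_top cr).
case: cr => _ []; rewrite /Gk.
case: alpha => [|[|[|a]]] //= cl _ pa win _.
case: exists_inP => [[v vG /dominatesP dom]|ex].
  rewrite subn1 /=.
  apply: capture_timeI.
    exists v => r; apply: cop_wins_shadow; first exact: proper_uptoW.
    by apply: dom; apply: shadow_in; apply: proper_uptoW.
  have pa1 := proper_uptoW (proper_uptoW pa).
  apply: (@not_wins_within a) => // [d dG|c r rG]; last exact: robber_survives.
  apply/negP => dm; apply/negP: (pa a.+1 (ltnSn _)); rewrite negbK.
  by apply: dominator_clique dm _ => //; apply: pa; apply: ltnW.
rewrite subn0; apply: capture_timeI => //.
have pa1 := proper_uptoW pa.
apply: (@not_wins_within a.+1) => // [d dG|c r rG]; last exact: robber_survives.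
apply/negP => dm; apply: ex; exists d => //.
have -> : rank_step adj (rank_step adj (G a)) = G a.+2 by [].
by rewrite GseqS ?dominates_core // pa.
Qed.

Lemma cop_win_corner_rank (v0 : T) : cop_win adj -> exists alpha, corner_rank adj alpha.
Proof.
case=> t win.
(* A level without strict corners equals its core, so a dominating vertex would make it a clique.
   Otherwise the robber can start, and then stay, out of reach there. *)
have nstuck j : proper_upto j -> ~~ is_clique adj (G j) -> X (G j) != set0.
  move=> pj nc; apply/eqP => X0.
  apply: (@not_wins_within j t) win => //; last by move=> c r; apply: robber_survives_stuck.
  move=> d dG; apply: contra nc => /(clique_core dG).
  by rewrite /core X0 setD0.
have exm : exists j, is_clique adj (G j).
  case: (boolP [exists j : 'I_#|T|.+1, is_clique adj (G j)]) => [/existsP[j]|/existsPn nc].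
    by exists j.
  have pj : proper_upto #|T|.+1 by move=> i ij; apply: (nc (Ordinal ij)).
  have dec j : j <= #|T| -> #|G j| + j <= #|T|.
    elim: j => [|j IH] jT; first by rewrite addn0 max_card.
    have ncj : ~~ is_clique adj (G j) by apply: pj; apply: ltnW.
    have := nstuck j (fun i ij => pj i (ltn_trans ij (leqW jT))) ncj.
    rewrite -card_gt0 GseqS // => X0; have := IH (ltnW jT).
    rewrite -(cardsID (X (G j)) (G j)) (setIidPr _).
      by move: X0; rewrite -/(core _); lia.
    by apply/subsetP => v; apply: strict_corners_sub.
  (* Each step deletes a vertex, so this level is empty, hence a clique. *)
  have G0 : G #|T| = set0 by apply/eqP; rewrite -cards_eq0; have := dec _ (leqnn _); lia.
  by exists #|T|; apply/is_cliqueP => u v; rewrite G0 inE.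
case: (ex_minnP exm) => m mcl mmin; exists m.+1.
have pm : proper_upto m by move=> i im; apply/negP => /mmin; rewrite leqNgt im.
split=> //; split=> // -[|k] //= km; rewrite /Gk /=.
have nck := pm k km; split=> //; apply: nstuck nck.
by move=> i ik; apply: pm; exact: ltn_trans ik km.
Qed.


(** * Small sets, and levels with a lone strict corner *)

Lemma card_exhaust (A : {set T}) (s : seq T) :
  uniq s -> {subset s <= A} -> #|A| <= size s -> {subset A <= s}.
Proof.
move=> us sA As x xA.
have sub : {subset s <= enum A} by move=> y /sA; rewrite mem_enum.
have [|_ e] := uniq_min_size us sub; first by rewrite -cardE.
by rewrite e mem_enum.
Qed.

Lemma card_exhaust2 (A : {set T}) x y : x \in A -> y \in A -> x != y -> #|A| <= 2 ->
  forall t, t \in A -> t = x \/ t = y.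
Proof.
move=> xA yA xy A2 t tA.
have: t \in [:: x; y].
  apply: card_exhaust tA => //=; first by rewrite inE xy.
  by move=> z; rewrite !inE => /orP[] /eqP->.
by rewrite !inE => /orP[] /eqP; auto.
Qed.

Lemma card_exhaust3 (A : {set T}) x y z : x \in A -> y \in A -> z \in A ->
  x != y -> x != z -> y != z -> #|A| <= 3 ->
  forall t, t \in A -> [\/ t = x, t = y | t = z].
Proof.
move=> xA yA zA xy xz yz A3 t tA.
have: t \in [:: x; y; z].
  apply: card_exhaust tA => //=; first by rewrite !inE negb_or xy xz yz.
  by move=> w; rewrite !inE => /or3P[] /eqP->.
by rewrite !inE => /or3P[] /eqP->; [constructor 1 | constructor 2 | constructor 3].
Qed.

Lemma card_exhaust4 (A : {set T}) x y z w : x \in A -> y \in A -> z \in A -> w \in A ->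
  uniq [:: x; y; z; w] -> #|A| <= 4 ->
  forall t, t \in A -> [\/ t = x, t = y, t = z | t = w].
Proof.
move=> xA yA zA wA us A4 t tA.
have: t \in [:: x; y; z; w].
  apply: card_exhaust tA => // v.
  by rewrite !inE => /or4P[] /eqP->.
by rewrite !inE => /or4P[] /eqP->;
  [constructor 1 | constructor 2 | constructor 3 | constructor 4].
Qed.

(* The obstruction that a lone strict corner creates one level above it; the
   cardinality constraints all come from refuting it. *)
Definition dominated S := exists2 d, d \in core S & {in X S, forall u, adj d u}.

(** The private neighbour given by [corners_private] can only be [u]. So every strict corner of
    [core S] is adjacent to [u], and whatever corners [u] is adjacent to all of them. *)
Lemma lone_corner S u : X S = [set u] ->
  (forall v w, corners (core S) v w -> adj v u /\ ~~ adj w u) /\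
  exists2 z, z \in core S & adj z u /\ {in X (core S), forall v, adj z v}.
Proof.
move=> XS; have priv v w : corners (core S) v w -> adj v u /\ ~~ adj w u.
  by case/corners_private=> u' []; rewrite XS => /set1P->.
split=> //; have /corners_core[z zC uz] : u \in X S by rewrite XS set11.
exists z => //; split; first exact: corners_adj uz.
move=> v /corners_core[w _ vw]; case: uz => _ _ sub _; case: vw (priv _ _ vw) => vC _ _ _ [vu _].
by apply: sub; [apply: core_sub | rewrite adj_sym].
Qed.

(** The vertex cornering the lone corner may itself be a strict corner of [core S]; a vertex of the
    next core that corners it then takes over. *)
Lemma lone_corner_dominated S : #|X S| = 1 -> dominated (core S).
Proof.
move=> /eqP/cards1P[u /lone_corner[_ [z zC [_ zX]]]].
case: (in_core_or_corner zC) => [zCC|/corners_core[w wC [_ _ sub _]]]; first by exists z.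
by exists w => // v vX; apply: sub; [apply: strict_corners_sub | apply: zX].
Qed.

Lemma dominator_corners_none S d v :
  {in X S, forall u, adj d u} -> corners (core S) v d -> False.
Proof. by move=> dX /corners_private[u [/dX ->]]. Qed.

(** Let [z] corner the lone [u]. A vertex of the clique that misses [u] would be cornered by [z]; so
    [u] is adjacent to the whole clique, and [S] is a clique. *)
Lemma card1_under_clique S :
  is_clique adj (core S) -> ~~ is_clique adj S -> #|X S| <> 1.
Proof.
move=> /is_cliqueP cl /negP nc /eqP/cards1P[u XS]; apply: nc.
have uX : u \in X S by rewrite XS set11.
have [z zC uz] := corners_core uX.
have inS y : y \in S -> y \in core S \/ y = u.
  by case/in_core_or_corner; [left | rewrite XS => /set1P; right].
have ku k : k \in core S -> adj k u.
  move=> kC; apply/negPn/negP => nku; apply: (core_cornerF kC).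
  apply: (@corners_strict _ _ z); split; try exact: core_sub.
    by move=> y /inS[yC _|->]; [apply: cl | rewrite (negbTE nku)].
  by exists u; split=> //; [apply: strict_corners_sub | apply: corners_adj uz].
apply/is_cliqueP => x y /inS[xC|->] /inS[yC|->] //; try exact: cl; try exact: ku.
by rewrite adj_sym ku.
Qed.

(** Let [z] corner the lone [u]. If [z] lies in the clique, it dominates [core S] and corners a
    vertex there while adjacent to [u], against [lone_corner]. If not, whatever corners [z]
    dominates [core S], hence so does the whole clique, and [z] has no non-neighbour. *)
Lemma card1_two_under_clique S :
  is_clique adj (core (core S)) -> X (core S) != set0 -> #|X S| <> 1.
Proof.
move=> /is_cliqueP cl /set0Pn[v vX] /eqP/cards1P[u /lone_corner[priv [z zC [zu zX]]]].
have dom w : w \in core (core S) -> {in X (core S), forall v, adj w v} ->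
    dominates adj w (core S).
  move=> wC wX; apply/dominatesP => y /in_core_or_corner[yC|]; last exact: wX.
  exact: cl.
case: (in_core_or_corner zC) => [zCC|zXC].
  have /dominatesP zd := dom _ zCC zX.
  have vz : corners (core S) v z.
    split=> //; [exact: strict_corners_sub | by move=> y yC _; apply: zd |].
    by have [y yC nvy] := strict_corner_nonadj vX; exists y; split; rewrite ?zd.
  by have [_] := priv _ _ vz; rewrite zu.
have [w wC [_ _ sub _]] := corners_core zXC.
have wd : dominates adj w (core S).
  by apply: dom => // y yX; apply: sub; [apply: strict_corners_sub | apply: zX].
have [y yC] := strict_corner_nonadj zXC; move/negP; apply.
case: (in_core_or_corner yC) => [yCC|]; last exact: zX.
rewrite adj_sym; move/dominatesP: (core_dominates (core_sub wC) wd yCC); exact.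
Qed.

Lemma apex S v : core S = [set v] ->
  (forall h, h \in X S -> corners S h v) /\ dominates adj v S.
Proof.
move=> CS; have ap h : h \in X S -> corners S h v.
  by case/corners_core => w; rewrite CS => /set1P->.
split=> //; apply/dominatesP => y /in_core_or_corner[|/ap yv]; last exact: corners_adj yv.
by rewrite CS => /set1P->.
Qed.

(** ** Pairs of separate ends *)

(** That [p1] is adjacent to [q1] is implicit: some vertex of the core corners [p1], and it can only
    be [q1]. *)
Definition two_ends S := exists p1 p2 q1 q2,
  [/\ p1 \in X S, p2 \in X S, q1 <> q2, {in core S, forall y, adj p1 y -> y = q1}
    & {in core S, forall y, adj p2 y -> y = q2}].

Lemma two_ends_dominated S : two_ends S -> ~ dominated S.
Proof.
move=> [p1 [p2 [q1 [q2 [p1X p2X q12 e1 e2]]]]] [d dC dX]; apply: q12.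
by rewrite -(e1 d) // -?(e2 d) // adj_sym dX.
Qed.

Lemma end_corner S p q : p \in X S -> {in core S, forall y, adj p y -> y = q} ->
  q \in core S /\ corners S p q.
Proof.
move=> pX e; have [w wC pw] := corners_core pX.
by rewrite -(e w wC) // adj_sym; apply: corners_adj pw.
Qed.

(** The vertex [c] cornering [s] is adjacent to [p]; in the second core it would be [q], which
    misses [s]. *)
Lemma end_private S p q : p \in X (core S) ->
  {in core (core S), forall y, adj p y -> y = q} ->
  exists s c, [/\ s \in X S, adj p s, ~~ adj q s, corners S s c & c \in X (core S) /\ adj p c].
Proof.
move=> pX e; have [qC pq] := end_corner pX e.
have [s [sX ps qs]] := corners_private pq.
have [c cC sc] := corners_core sX.
have cp : adj c p.
  by case: sc => _ _ sub _; apply: sub; rewrite 1?adj_sym //; apply/core_sub/strict_corners_sub.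
exists s, c; split=> //; rewrite adj_sym; split=> //.
case: (in_core_or_corner cC) => // cCC.
by case/negP: qs; rewrite -(e c) ?(corners_adj sc) // adj_sym.
Qed.

Lemma ends_separated S p1 p2 q1 q2 x : p1 \in X S -> p2 \in X S -> q1 <> q2 ->
  {in core S, forall y, adj p1 y -> y = q1} ->
  {in core S, forall y, adj p2 y -> y = q2} ->
  x \in S -> adj p1 x -> adj p2 x -> False.
Proof.
move=> p1X p2X q12 e1 e2 xS p1x p2x; apply: q12.
have [w wC [w1 w2]] : exists2 w, w \in core S & adj p1 w /\ adj p2 w.
  case: (in_core_or_corner xS) => [xC|/corners_core[w wC [_ _ sub _]]]; first by exists x.
  by exists w => //; split; rewrite adj_sym; apply: sub; rewrite 1?adj_sym //;
     apply: strict_corners_sub.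
by rewrite -(e1 w) // -(e2 w).
Qed.

(** The ends move one level down: [p1] and [p2] are the only strict corners and are not adjacent, so
    the private neighbour [s1] is cornered by [p1] and sees only [p1] in [core S]; likewise [s2]. *)
Lemma two_ends_core S : two_ends (core S) -> #|X (core S)| = 2 -> two_ends S.
Proof.
move=> [p1 [p2 [q1 [q2 [p1X p2X q12 e1 e2]]]]] X2.
have sep := ends_separated p1X p2X q12 e1 e2.
have p1C := strict_corners_sub p1X; have p2C := strict_corners_sub p2X.
have n12 : ~~ adj p1 p2 by apply/negP=> a; apply: (sep p2).
have p12 : p1 != p2 by apply: contraNneq n12 => ->.
have XE x : x \in X (core S) -> x = p1 \/ x = p2.
  by apply: card_exhaust2; rewrite ?X2.
have [s1 [c1 [s1X ps1 qs1 [_ _ sub1 _] [c1X pc1]]]] := end_private p1X e1.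
have [s2 [c2 [s2X ps2 qs2 [_ _ sub2 _] [c2X pc2]]]] := end_private p2X e2.
have ec1 : c1 = p1 by case: (XE c1 c1X) pc1 => -> //; rewrite (negbTE n12).
have ec2 : c2 = p2 by case: (XE c2 c2X) pc2 => -> //; rewrite adj_sym (negbTE n12).
subst c1 c2.
exists s1, s2, p1, p2; split=> //; first exact/eqP.
  move=> y yC s1y; have p1y : adj p1 y by apply: sub1 => //; apply: core_sub.
  case: (in_core_or_corner yC) => [yCC|/XE[->//|ey]].
    by case/negP: qs1; rewrite -(e1 y) // adj_sym.
  by rewrite ey (negbTE n12) in p1y.
move=> y yC s2y; have p2y : adj p2 y by apply: sub2 => //; apply: core_sub.
case: (in_core_or_corner yC) => [yCC|/XE[ey|->//]].
  by case/negP: qs2; rewrite -(e2 y) // adj_sym.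
by rewrite ey adj_sym (negbTE n12) in p2y.
Qed.

(** A third strict corner is allowed here. The dominator [d] is adjacent to both cornering vertices
    [c1] and [c2], and with so few strict corners every case yields a common neighbour of [p1] and
    [p2]. *)
Lemma two_ends_core_dominated S : two_ends (core S) -> #|X (core S)| <= 3 -> ~ dominated S.
Proof.
move=> [p1 [p2 [q1 [q2 [p1X p2X q12 e1 e2]]]]] X3 [d dC dX].
have sep := ends_separated p1X p2X q12 e1 e2.
have p1C := strict_corners_sub p1X; have p2C := strict_corners_sub p2X.
have n12 : ~~ adj p1 p2 by apply/negP=> a; apply: (sep p2).
have p12 : p1 != p2 by apply: contraNneq n12 => ->.
have [q1C pq1] := end_corner p1X e1; have [q2C pq2] := end_corner p2X e2.
have XE r x : r \in X (core S) -> x \in X (core S) -> r != p1 -> r != p2 ->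
    [\/ x = p1, x = p2 | x = r].
  by move=> rX xX r1 r2; apply: card_exhaust3 xX; rewrite // eq_sym.
have [s1 [c1 [s1X ps1 qs1 [_ _ sub1 _] [c1X pc1]]]] := end_private p1X e1.
have [s2 [c2 [s2X ps2 qs2 [_ _ sub2 _] [c2X pc2]]]] := end_private p2X e2.
have dS := core_sub dC.
have cd1 : adj d c1 by rewrite adj_sym; apply: sub1 => //; rewrite adj_sym dX.
have cd2 : adj d c2 by rewrite adj_sym; apply: sub2 => //; rewrite adj_sym dX.
have c12 : c1 != p2 by apply: contraNneq n12 => <-.
have c21 : c2 != p1 by apply: contraNneq n12 => <-; rewrite adj_sym.
have c1C := strict_corners_sub c1X; have c2C := strict_corners_sub c2X.
have dXX p q : (p = p1 /\ q = q1) \/ (p = p2 /\ q = q2) -> adj d p -> d \in X (core S).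
  move=> pq dp; case: (in_core_or_corner dC) => // dCC; exfalso.
  have dq : d = q by case: pq dp => -[-> ->] dp; [apply: e1|apply: e2]; rewrite 1?adj_sym.
  by apply: (dominator_corners_none dX (v := p)); rewrite dq; case: pq => -[-> ->].
case: (eqVneq c1 p1) cd1 => [-> dp1|c11 cd1]; last first.
  case: (eqVneq c2 p2) cd2 => [-> dp2|c22 cd2]; last first.
    case: (XE c1 c2) => // ec; [by rewrite ec eqxx in c21|by rewrite ec eqxx in c22|].
    by apply: (sep c1) => //; rewrite -ec.
  have dXC : d \in X (core S) by apply: (dXX p2 q2) => //; right.
  case: (XE c1 d) => // ed; subst d.
  - by rewrite (negbTE n12) in dp2.
  - by apply: (sep c1).
  - by apply: (sep c1) => //; rewrite adj_sym.
case: (eqVneq c2 p2) cd2 => [-> dp2|c22 cd2].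
  by apply: (sep d) => //; rewrite adj_sym.
have dXC : d \in X (core S) by apply: (dXX p1 q1) => //; left.
case: (XE c2 d) => // ed; subst d.
- by apply: (sep c2).
- by rewrite adj_sym (negbTE n12) in dp1.
- by apply: (sep c2) => //; rewrite adj_sym.
Qed.

(** A vertex cornering [u] is adjacent to [h1] and [u], which excludes the second core by hypothesis
    and [h2] by non-adjacency; so it is [h1]. The same exclusions then apply to any neighbour of
    [u]. *)
Lemma isolated_end S h1 h2 u : X (core S) = [set h1; h2] -> ~~ adj h1 h2 ->
  u \in X S -> adj h1 u ->
  {in core (core S), forall k, adj k h1 -> ~~ adj k u} ->
  {in core S, forall y, adj u y -> y = h1}.
Proof.
move=> XE n12 uX hu ku y yC uy; have [c cC uc] := corners_core uX.
have h1X : h1 \in X (core S) by rewrite XE !inE eqxx.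
have h1S := core_sub (strict_corners_sub h1X); have yS := core_sub yC.
have ch : adj c h1 by case: uc => _ _ sub _; apply: sub; rewrite // adj_sym.
have cy : adj c y by case: uc => _ _ sub _; apply: sub.
have cu := corners_adj uc.
case: (in_core_or_corner cC) => [/ku/(_ ch)|]; first by rewrite cu.
rewrite XE => /set2P[] ec; last by rewrite ec adj_sym (negbTE n12) in ch.
rewrite {}ec in cy; case: (in_core_or_corner yC) => [/ku|].
  by rewrite adj_sym => /(_ cy); rewrite adj_sym uy.
by rewrite XE => /set2P[] // ey; rewrite ey (negbTE n12) in cy.
Qed.

Lemma isolated_pair_two_ends S h1 h2 u1 u2 : h1 != h2 -> X (core S) = [set h1; h2] ->
  ~~ adj h1 h2 -> u1 \in X S -> u2 \in X S -> adj h1 u1 -> adj h2 u2 ->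
  {in core (core S), forall k, adj k h1 -> ~~ adj k u1} ->
  {in core (core S), forall k, adj k h2 -> ~~ adj k u2} -> two_ends S.
Proof.
move=> h12 XE n12 u1X u2X hu1 hu2 ku1 ku2.
exists u1, u2, h1, h2; split=> //; [exact/eqP | exact: (isolated_end XE n12) |].
by apply: (@isolated_end _ _ h1) ku2; rewrite // 1?setUC // adj_sym.
Qed.

(* Since [d] dominates [X S] it corners nothing in [core S]; the end [u'] pins
   [d] to [u'], which is out of reach of the corners adjacent to [u]. *)
Lemma end_and_pair_dominated S u u' a1 a2 b :
  X (core S) = [set u; u'] -> b <> a1 -> b <> a2 ->
  {in core (core S), forall y, adj u y -> y = a1 \/ y = a2} ->
  {in core (core S), forall y, adj u' y -> y = b} -> ~ dominated S.
Proof.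
move=> XE ba1 ba2 eu eu' [d dC dX].
have uX : u \in X (core S) by rewrite XE !inE eqxx.
have u'X : u' \in X (core S) by rewrite XE !inE eqxx orbT.
have [bC u'b] := end_corner u'X eu'.
have [s [c [sX us bs sc [cX u'c]]]] := end_private u'X eu'.
have n_u : ~~ adj u' u.
  apply/negP=> uu'; case: (eu b) => //; rewrite adj_sym.
  by case: u'b => _ _ sub _; apply: sub => //; apply: strict_corners_sub.
have inu' y : y \in core S -> adj u' y -> y = u' \/ y = b.
  case/in_core_or_corner => [yC /(eu' y yC)|]; first by right.
  by rewrite XE => /set2P[] ->; [rewrite (negbTE n_u) | left].
have dominate x y : x \in X S -> corners S x y -> adj d y.
  move=> xX [_ _ sub _]; rewrite adj_sym; apply: sub; first exact: core_sub.
  by rewrite adj_sym dX.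
have ec : c = u'.
  case: (inu' c) => //; first exact: strict_corners_sub.
  by move=> cb; move: bs; rewrite -cb (corners_adj sc).
subst c; have ed : d = u'.
  case: (inu' d) => //; first by rewrite adj_sym; apply: dominate sc.
  by move=> db; subst d; case: (dominator_corners_none dX u'b).
(* Now [d] is [u']. Whatever corners a private neighbour of [u] is adjacent to both [u] and [u'],
   which their lists of neighbours exclude. *)
have [w wC uw] := corners_core uX.
have [t [tX ut wt]] := corners_private uw.
have [e eC te] := corners_core tX.
have ue : adj u e.
  rewrite adj_sym; case: te => _ _ sub _; apply: sub; rewrite 1?adj_sym //.
  by apply: core_sub; apply: strict_corners_sub.
have := dominate _ _ tX te; rewrite ed => /(inu' _ eC) [] ee; subst e.
  by rewrite adj_sym (negbTE n_u) in ue.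
by case: (eu b bC ue).
Qed.

(** ** A single vertex of top rank *)

Section Apex.
Variables (S : {set T}) (v : T).
Hypothesis CS : core (core S) = [set v].
Let S1 := core S.

Let vC : v \in core S1. Proof. by rewrite CS set11. Qed.
Let corner_v h : h \in X S1 -> corners S1 h v. Proof. by case: (apex CS) => ap _; apply: ap. Qed.
Let adj_v y : y \in S1 -> adj v y.
Proof. by case: (apex CS) => _ /dominatesP; apply. Qed.
Let inS1 y : y \in S1 -> y = v \/ y \in X S1.
Proof. by case/in_core_or_corner; [rewrite CS => /set1P|]; auto. Qed.

Lemma apex_nonadj h : h \in X S1 -> exists2 y, y \in X S1 & ~~ adj h y.
Proof.
move=> hX; have [y yC nhy] := strict_corner_nonadj hX; exists y => //.
case: (inS1 yC) => // ey; move: nhy; rewrite ey adj_sym adj_v //.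
exact: strict_corners_sub.
Qed.

Lemma apex_private h : h \in X S1 -> exists u c,
  [/\ u \in X S, adj h u, ~~ adj v u, corners S u c & c \in X S1 /\ adj c h].
Proof.
move=> hX; have [u [uX hu vu]] := corners_private (corner_v hX).
have [c cC uc] := corners_core uX; exists u, c; split=> //; split.
  by case: (inS1 cC) => // ec; rewrite -ec (corners_adj uc) in vu.
case: uc => _ _ sub _; apply: sub; last by rewrite adj_sym.
by apply: core_sub; apply: strict_corners_sub.
Qed.

Lemma apex_pair_two_ends : #|X S1| = 2 -> two_ends S.
Proof.
move=> /eqP/cards2P[h1 [h2 [h12 XE]]].
have h1X : h1 \in X S1 by rewrite XE !inE eqxx.
have h2X : h2 \in X S1 by rewrite XE !inE eqxx orbT.
have [y yX n1] := apex_nonadj h1X.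
have n12 : ~~ adj h1 h2 by move: yX n1; rewrite XE => /set2P[] -> //; rewrite adj_refl.
have [u1 [_ [u1X hu1 vu1 _ _]]] := apex_private h1X.
have [u2 [_ [u2X hu2 vu2 _ _]]] := apex_private h2X.
by apply: (isolated_pair_two_ends h12 XE n12 u1X u2X hu1 hu2) => k;
   rewrite CS => /set1P->.
Qed.

(** The dominator corners nothing, so it is not [v] but a strict corner. A strict corner [h] that it
    misses has a private neighbour, cornered by some [c] adjacent to [h] and [d]; these are all
    three strict corners, so [c] misses none, against [apex_nonadj]. *)
Lemma apex_triple_dominated : #|X S1| = 3 -> ~ dominated S.
Proof.
move=> X3 [d dC dX].
have [h0 h0X] : exists h, h \in X S1 by apply/set0Pn; rewrite -card_gt0 X3.
have dX1 : d \in X S1.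
  by case: (inS1 dC) => // dv; case: (dominator_corners_none dX (v := h0)); rewrite dv; apply: corner_v.
have [h hX ndh] := apex_nonadj dX1.
have [u [c [uX hu vu uc [cX ch]]]] := apex_private hX.
have cd : adj c d.
  by case: uc => _ _ sub _; apply: sub; [apply: core_sub | rewrite adj_sym dX].
have [y yX ncy] := apex_nonadj cX.
have hc : h != c by apply: contraNneq ndh => ->; rewrite adj_sym.
have hd : h != d by apply: contraNneq ndh => ->.
have cd' : c != d by apply: contraNneq ndh => <-.
have := card_exhaust3 hX cX dX1 hc hd cd' (eq_leq X3) yX.
by case=> ey; move: ncy; rewrite ey ?adj_refl ?ch ?cd.
Qed.

End Apex.

Lemma apex_triple_pair_dominated S v : core (core (core S)) = [set v] ->
  #|X (core (core S))| = 3 -> #|X (core S)| = 2 -> ~ dominated S.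
Proof.
move=> CS X3 X2; have [_ /dominatesP vdom] := apex CS.
have [h0 h0X] : exists h, h \in X (core (core S)) by apply/set0Pn; rewrite -card_gt0 X3.
(* Each of the three strict corners misses another one, so some [b] misses both others. *)
suff main a1 a2 b : a1 \in X (core (core S)) -> a2 \in X (core (core S)) ->
    b \in X (core (core S)) -> a1 != a2 -> ~~ adj a1 b -> ~~ adj a2 b -> ~ dominated S.
  have [h1 h1X n01] := apex_nonadj CS h0X.
  have h01 : h0 != h1 by apply: contraNneq n01 => <-.
  have [h2 [h2X h20 h21]] : exists h2, [/\ h2 \in X (core (core S)), h2 != h0 & h2 != h1].
    case: (pickP [pred h in X (core (core S)) | (h != h0) && (h != h1)]).
      by move=> h2 /and3P[]; exists h2.
    move=> no; have sub : X (core (core S)) \subset [set h0; h1].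
      apply/subsetP => x xX; have /= := no x; rewrite in_set2 xX /=.
      by case: eqP => //= _ /negbFE.
    by have := subset_leq_card sub; rewrite X3 cards2 h01.
  have [y yX n2y] := apex_nonadj CS h2X.
  have := card_exhaust3 h0X h1X h2X h01 _ _ (eq_leq X3) yX.
  rewrite (eq_sym h0) (eq_sym h1) h20 h21 => /(_ isT isT) [] ey; subst y.
  - by apply: (main h1 h2 h0) => //; rewrite 1?eq_sym // adj_sym.
  - by apply: (main h0 h2 h1) => //; rewrite 1?eq_sym.
  - by rewrite adj_refl in n2y.
move=> a1X a2X bX a12 n1 n2.
have b1 : a1 != b by apply: contraNneq n1 => ->.
have b2 : a2 != b by apply: contraNneq n2 => ->.
have ex := card_exhaust3 a1X a2X bX a12 b1 b2 (eq_leq X3).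
(* The private neighbours [u] of [a1] and [u'] of [b] will be all of [X (core S)]; in the next core
   [u] sees at most [a1] and [a2], and [u'] only [b]. *)
have [u [c [uX au vu uc [cX ca]]]] := apex_private CS a1X.
have [u' [c' [u'X bu' vu' u'c [c'X c'b]]]] := apex_private CS bX.
have inS1 y : y \in core (core S) -> ~~ adj v y \/ y = v \/ y \in X (core (core S)).
  by case/in_core_or_corner; [rewrite CS => /set1P|]; auto.
have ec' : c' = b.
  by case: (ex c' c'X) c'b => -> //; rewrite ?(negbTE n1) ?(negbTE n2).
have bS := strict_corners_sub bX.
have cnb : ~~ adj c b.
  by case: (ex c cX) ca => -> //; rewrite adj_sym (negbTE n1).
have uE y : y \in core (core S) -> adj u y -> y = a1 \/ y = a2.
  move=> yC uy; case: (inS1 y yC) => [|[] ]; first by rewrite vdom.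
    by move=> yv; rewrite -yv adj_sym uy in vu.
  case/ex; [by left|by right|] => yb; case/negP: cnb; rewrite -yb.
  by case: uc => _ _ sub _; apply: sub => //; apply: core_sub.
have u'E y : y \in core (core S) -> adj u' y -> y = b.
  move=> yC uy; case: (inS1 y yC) => [|[] ]; first by rewrite vdom.
    by move=> yv; rewrite -yv adj_sym uy in vu'.
  have by' : adj b y.
    by rewrite -ec'; case: u'c => _ _ sub _; apply: sub => //; apply: core_sub.
  by case/ex => // ey; move: by'; rewrite ey adj_sym ?(negbTE n1) ?(negbTE n2).
have uu' : u != u'.
  apply/eqP => e; rewrite -e in u'E; have := u'E a1 (strict_corners_sub a1X).
  by rewrite adj_sym => /(_ au) e1; rewrite e1 eqxx in b1.
have XE : X (core S) = [set u; u'].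
  apply/setP => x; rewrite in_set2; apply/idP/orP => [|[] /eqP-> //].
  by move=> xX; case: (card_exhaust2 uX u'X uu' (eq_leq X2) xX) => ->; rewrite eqxx; auto.
apply: (end_and_pair_dominated XE (a1 := a1) (a2 := a2) (b := b)) => //;
  by move=> e; move: b1 b2; rewrite e eqxx.
Qed.

(** ** Type 0 *)

Section NoApex.
Variable S : {set T}.
Let S1 := core S.
Let S0 := core S1.
Hypothesis clS0 : {in S0 &, forall x y, adj x y}.
Hypothesis nd : {in S0, forall k, ~~ dominates adj k S1}.

Let top_nonadj k : k \in S0 -> exists2 h, h \in X S1 & ~~ adj k h.
Proof.
move=> kS; have /forall_inPn[h hC nkh] := nd kS; exists h => //.
by case: (in_core_or_corner hC) => // hS; rewrite clS0 in nkh.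
Qed.

(** No top vertex dominates [S1], so one adjacent to [h1] misses [h2]. If [h1] and [h2] were
    adjacent, a top vertex cornering [h1] would be adjacent to both. *)
Lemma pair_split : #|X S1| = 2 -> exists h1 h2,
  [/\ h1 != h2, X S1 = [set h1; h2], ~~ adj h1 h2
    & {in S0, forall k, adj k h1 -> ~~ adj k h2}].
Proof.
move=> /eqP/cards2P[h1 [h2 [h12 XE]]]; exists h1, h2.
have nc : {in S0, forall k, adj k h1 -> ~~ adj k h2}.
  by move=> k /top_nonadj[h]; rewrite XE => /set2P[] -> // /negbTE->.
split=> //; apply/negP => a; have h1X : h1 \in X S1 by rewrite XE !inE eqxx.
have [k kS hk] := corners_core h1X.
have h2X : h2 \in X S1 by rewrite XE !inE eqxx orbT.
case/negP: (nc k kS (corners_adj hk)); case: hk => _ _ sub _; apply: sub => //.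
exact: strict_corners_sub.
Qed.

Lemma pair_corners h1 h2 k : X S1 = [set h1; h2] -> ~~ adj h1 h2 ->
  {in S0, forall k, adj k h1 -> ~~ adj k h2} ->
  k \in S0 -> adj k h1 -> corners S1 h1 k.
Proof.
move=> XE n12 nc kS kh.
have h1X : h1 \in X S1 by rewrite XE !inE eqxx.
have h2X : h2 \in X S1 by rewrite XE !inE eqxx orbT.
split; [exact: strict_corners_sub | exact: core_sub | |].
  move=> y /in_core_or_corner[yS _|]; first exact: clS0.
  by rewrite XE => /set2P[] -> //; rewrite (negbTE n12).
have [k2 k2S /corners_adj kh2] := corners_core h2X.
exists k2; split; [exact: core_sub | exact: clS0 |].
by apply/negP => a; have := nc k2 k2S; rewrite adj_sym a kh2 => /(_ isT).
Qed.

Lemma pair_private h1 h2 k : X S1 = [set h1; h2] -> ~~ adj h1 h2 ->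
  {in S0, forall k, adj k h1 -> ~~ adj k h2} ->
  k \in S0 -> adj k h1 -> exists u c, [/\ u \in X S, adj h1 u, ~~ adj k u, corners S u c &
    [/\ adj c h1, c != k & c = h1 \/ c \in S0]].
Proof.
move=> XE n12 nc kS kh; have hk := pair_corners XE n12 nc kS kh.
have [u [uX hu ku]] := corners_private hk; have [c cC uc] := corners_core uX.
have h1X : h1 \in X S1 by rewrite XE !inE eqxx.
have ch : adj c h1.
  case: uc => _ _ sub _; apply: sub; last by rewrite adj_sym.
  by apply: core_sub; apply: strict_corners_sub.
exists u, c; split=> //; split=> //.
  by apply: contraNneq ku => <-; apply: corners_adj uc.
case: (in_core_or_corner cC) => [|]; first by right.
by rewrite XE => /set2P[]; [left | move=> ec; rewrite ec adj_sym (negbTE n12) in ch].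
Qed.

(** The dominator lies in the clique and misses [h1] and [h2], as it would corner one it is adjacent
    to. Each of them has two neighbours in the clique, none in common, so with [d] the clique has
    five vertices. *)
Lemma pair_dominated : #|X S1| = 2 -> #|S0| <= 4 -> ~ dominated S.
Proof.
move=> X2 S4 [d dC dX]; have [h1 [h2 [h12 XE n12 nc]]] := pair_split X2.
have XE' : X S1 = [set h2; h1] by rewrite XE setUC.
have n21 : ~~ adj h2 h1 by rewrite adj_sym.
have nc' : {in S0, forall k, adj k h2 -> ~~ adj k h1}.
  by move=> k kS a; apply/negP => /(nc k kS); rewrite a.
have h1X : h1 \in X S1 by rewrite XE !inE eqxx.
have h2X : h2 \in X S1 by rewrite XE !inE eqxx orbT.
have [k1 k1S /corners_adj kh1] := corners_core h1X.
have [k2 k2S /corners_adj kh2] := corners_core h2X.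
have [u1 [c1 [u1X hu1 _ uc1 [ch1 ck1 cS1]]]] := pair_private XE n12 nc k1S kh1.
have [u2 [c2 [u2X hu2 _ uc2 [ch2 ck2 cS2]]]] := pair_private XE' n21 nc' k2S kh2.
have dc u c : u \in X S -> corners S u c -> adj c d.
  move=> uX [_ _ sub _]; apply: sub; first exact: core_sub.
  by rewrite adj_sym dX.
have dc1 := dc _ _ u1X uc1; have dc2 := dc _ _ u2X uc2.
have n_d h h' : X S1 = [set h; h'] -> ~~ adj h h' ->
    {in S0, forall k, adj k h -> ~~ adj k h'} -> d \in S0 -> ~~ adj d h.
  move=> E n c dS; apply/negP => dh.
  exact: (dominator_corners_none dX (pair_corners E n c dS dh)).
have dS : d \in S0.
  case: (in_core_or_corner dC) => // dX1; exfalso.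
  move: dX1; rewrite XE => /set2P[] ed; subst d.
    case: cS2 => [e2|c2S]; first by rewrite e2 adj_sym (negbTE n12) in dc2.
    by have := nc' c2 c2S ch2; rewrite dc2.
  case: cS1 => [e1|c1S]; first by rewrite e1 (negbTE n12) in dc1.
  by have := nc c1 c1S ch1; rewrite dc1.
have nd1 := n_d _ _ XE n12 nc dS; have nd2 := n_d _ _ XE' n21 nc' dS.
have c1S : c1 \in S0 by case: cS1 dc1 => // ->; rewrite adj_sym (negbTE nd1).
have c2S : c2 \in S0 by case: cS2 dc2 => // ->; rewrite adj_sym (negbTE nd2).
have neq12 x y : x \in S0 -> adj x h1 -> adj y h2 -> x != y.
  by move=> xS xh yh; apply: contraTneq yh => <-; apply: nc.
have us : uniq [:: k1; c1; k2; c2].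
  rewrite /= !inE !negb_or (eq_sym k1 c1) (eq_sym k2 c2) ck1 ck2 !andbT /=.
  by rewrite (neq12 k1 k2) ?(neq12 k1 c2) ?(neq12 c1 k2) ?(neq12 c1 c2).
case: (card_exhaust4 k1S c1S k2S c2S us S4 dS) => ed; subst d.
- by rewrite kh1 in nd1.
- by rewrite ch1 in nd1.
- by rewrite kh2 in nd2.
- by rewrite ch2 in nd2.
Qed.

(** For [h1], whose only top neighbour is [k1], [isolated_end] applies directly. If [h2] has a
    second top neighbour [k], then [u1] misses [h2], so for want of strict corners in [S] the
    private neighbours of [h2] with respect to [k2] and [k] coincide. *)
Let pair_two_ends_aux h1 h2 k1 : h1 != h2 -> X S1 = [set h1; h2] -> ~~ adj h1 h2 ->
  {in S0, forall k, adj k h1 -> ~~ adj k h2} -> k1 \in S0 -> adj k1 h1 ->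
  {in S0, forall k, adj k h1 -> k = k1} ->
  #|S0| <= 2 \/ #|S0| <= 3 /\ #|X S| <= 2 -> two_ends S.
Proof.
move=> h12 XE n12 nc k1S kh1 k1u bnd.
have XE' : X S1 = [set h2; h1] by rewrite XE setUC.
have n21 : ~~ adj h2 h1 by rewrite adj_sym.
have nc' : {in S0, forall k, adj k h2 -> ~~ adj k h1}.
  by move=> k kS a; apply/negP => /(nc k kS); rewrite a.
have h2X : h2 \in X S1 by rewrite XE !inE eqxx orbT.
have [k2 k2S /corners_adj kh2] := corners_core h2X.
have [u1 [c1 [u1X hu1 ku1 uc1 [ch1 ck1 cS1]]]] := pair_private XE n12 nc k1S kh1.
have [u2 [_ [u2X hu2 ku2 _ _]]] := pair_private XE' n21 nc' k2S kh2.
apply: (isolated_pair_two_ends h12 XE n12 u1X u2X) => // k kS kh.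
  by rewrite (k1u k).
have [->//|kk2] := eqVneq k k2.
have neq x : adj x h2 -> k1 != x.
  by move=> xh; apply: contraTneq xh => <-; apply: nc.
have k12 := neq k2 kh2; have k1k := neq k kh.
case: bnd => [S2|[S3 X2]].
  by case: (card_exhaust2 k1S k2S k12 S2 kS) kk2 k1k => ->; rewrite eqxx.
have ec1 : c1 = h1 by case: cS1 => // c1S; move: ck1; rewrite (k1u c1) ?eqxx.
have n1 : ~~ adj h2 u1.
  apply/negP => a; case/negP: n12; rewrite -ec1; case: uc1 => _ _ sub _; apply: sub.
    by apply: core_sub; apply: strict_corners_sub.
  by rewrite adj_sym.
have [u3 [_ [u3X hu3 ku3 _ _]]] := pair_private XE' n21 nc' kS kh.
have u12 : u1 != u2 by apply: contraNneq n1 => ->.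
by case: (card_exhaust2 u1X u2X u12 X2 u3X) hu3 ku3 => ->; rewrite ?(negbTE n1).
Qed.

(** The neighbourhoods of [h1] and [h2] in the clique are disjoint and nonempty, so among at most
    three vertices one of them is a singleton. *)
Lemma pair_two_ends : #|X S1| = 2 ->
  #|S0| <= 2 \/ #|S0| <= 3 /\ #|X S| <= 2 -> two_ends S.
Proof.
move=> X2 bnd; have [h1 [h2 [h12 XE n12 nc]]] := pair_split X2.
have XE' : X S1 = [set h2; h1] by rewrite XE setUC.
have n21 : ~~ adj h2 h1 by rewrite adj_sym.
have nc' : {in S0, forall k, adj k h2 -> ~~ adj k h1}.
  by move=> k kS a; apply/negP => /(nc k kS); rewrite a.
have h1X : h1 \in X S1 by rewrite XE !inE eqxx.
have h2X : h2 \in X S1 by rewrite XE !inE eqxx orbT.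
have [k1 k1S /corners_adj kh1] := corners_core h1X.
have [k2 k2S /corners_adj kh2] := corners_core h2X.
case: (pickP [pred k in S0 | adj k h1 && (k != k1)]) => [k /and3P[kS kh kk1]|u1].
  apply: (pair_two_ends_aux _ XE' n21 nc' k2S kh2) => //; first by rewrite eq_sym.
  move=> k' k'S k'h.
  have neq x y : x \in S0 -> adj x h1 -> adj y h2 -> x != y.
    by move=> xS xh yh; apply: contraTneq yh => <-; apply: nc.
  have k1k : k1 != k by rewrite eq_sym.
  have S3 : #|S0| <= 3 by case: bnd => [/leqW|[]].
  have := card_exhaust3 k1S kS k2S k1k (neq _ _ k1S kh1 kh2) (neq _ _ kS kh kh2) S3 k'S.
  by case=> // ek; move: (nc' _ k'S k'h); rewrite ek ?kh1 ?kh.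
apply: (pair_two_ends_aux h12 XE n12 nc k1S kh1) => // k kS kh.
by apply/eqP; have /= := u1 k; rewrite kS kh => /negbFE.
Qed.

Lemma two_tops_split : #|S0| = 2 -> exists k1 k2 a b,
  [/\ S0 = [set k1; k2], corners S1 a k1 /\ ~~ adj k2 a & corners S1 b k2 /\ ~~ adj k1 b].
Proof.
move=> /eqP/cards2P[k1 [k2 [k12 SE]]].
have k1S : k1 \in S0 by rewrite SE !inE eqxx.
have k2S : k2 \in S0 by rewrite SE !inE eqxx orbT.
have [a aX k2a] := top_nonadj k2S; have [b bX k1b] := top_nonadj k1S.
exists k1, k2, a, b; split=> //; split=> //.
  have [k] := corners_core aX; rewrite -/S0 SE => /set2P[] -> // /corners_adj.
  by rewrite (negbTE k2a).
have [k] := corners_core bX; rewrite -/S0 SE => /set2P[] -> // /corners_adj.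
by rewrite (negbTE k1b).
Qed.

(** The vertices [c1], [c2] cornering private neighbours of [a], [b] are strict corners adjacent to
    [d]. If [a], [b], [d], [c2] are all the strict corners, [c1] is [a] or [d], so [d] is adjacent
    to [a] and misses only [b]. But [k1] misses [b] too, so it does not corner [d]. *)
Let two_tops_aux k1 k2 a b d : S0 = [set k1; k2] ->
  corners S1 a k1 -> ~~ adj k2 a -> corners S1 b k2 -> ~~ adj k1 b ->
  d \in X S1 -> {in X S, forall u, adj d u} -> corners S1 d k1 -> 4 < #|X S1|.
Proof.
move=> SE ak1 k2a bk2 k1b dX1 dX dk1; rewrite ltnNge; apply/negP => X4.
have aX := corners_strict ak1; have bX := corners_strict bk2.
have aC := strict_corners_sub aX; have bC := strict_corners_sub bX.
have dC := strict_corners_sub dX1.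
have priv h k : corners S1 h k -> exists c,
    [/\ c \in S1, c != k, adj c h & adj c d].
  move=> hk; have [u [uX hu ku]] := corners_private hk.
  have [c cC uc] := corners_core uX; exists c; split=> //.
  - by apply: contraNneq ku => <-; apply: corners_adj uc.
  - case: uc => _ _ sub _; apply: sub; last by rewrite adj_sym.
    by apply: core_sub; case: hk.
  - case: uc => _ _ sub _; apply: sub; first exact: core_sub.
    by rewrite adj_sym dX.
have inS1 y : y \in S1 -> [\/ y = k1, y = k2 | y \in X S1].
  case/in_core_or_corner; last by constructor 3.
  by rewrite -/S0 SE => /set2P[]; [constructor 1 | constructor 2].
have sub_k h k y : corners S1 h k -> y \in S1 -> adj h y -> adj k y.
  by case=> _ _ sub _; apply: sub.
have nab : ~~ adj a b by apply: contra k1b; apply: sub_k ak1 _.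
have [c1 [c1C c1k1 c1a c1d]] := priv _ _ ak1.
have [c2 [c2C c2k2 c2b c2d]] := priv _ _ bk2.
have c1X : c1 \in X S1.
  by case: (inS1 _ c1C) => // e; [rewrite e eqxx in c1k1 | rewrite e (negbTE k2a) in c1a].
have c2X : c2 \in X S1.
  by case: (inS1 _ c2C) => // e; [rewrite e (negbTE k1b) in c2b | rewrite e eqxx in c2k2].
have k1c2 : adj k1 c2 by apply: (sub_k _ _ _ dk1) => //; rewrite adj_sym.
have c2k : corners S1 c2 k2.
  have [k] := corners_core c2X; rewrite -/S0 SE => /set2P[] -> // c2k1.
  by rewrite (sub_k _ _ _ c2k1 bC c2b) in k1b.
have c2a : ~~ adj c2 a by apply: contra k2a; apply: sub_k c2k _.
have k2c2 := corners_adj c2k.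
have ndb : ~~ adj d b by apply: contra k1b; apply: sub_k dk1 _.
have k2d : adj k2 d by apply: (sub_k _ _ _ c2k).
have us : uniq [:: a; b; d; c2].
  rewrite /= !inE !negb_or !andbT; apply/and3P; split; first (apply/and3P; split).
  - by apply: contraNneq nab => ->.
  - by apply: contraNneq k2a => ->.
  - by apply: contraNneq k2a => ->.
  - by apply/andP; split; apply: contraNneq k1b => ->; rewrite ?(corners_adj dk1).
  - by apply: contraNneq ndb => ->.
have ex := card_exhaust4 aX bX dX1 c2X us X4.
have da : adj d a.
  case: (ex c1 c1X) c1a c1d => ->.
  - by rewrite adj_sym.
  - by rewrite adj_sym (negbTE nab).
  - by [].
  - by rewrite (negbTE c2a).
case: (dk1) => _ _ _ [y [yC k1y ndy]].
case: (inS1 y yC) => [ey|ey|yX].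
- by rewrite ey adj_sym (corners_adj dk1) in ndy.
- by rewrite ey adj_sym k2d in ndy.
case: (ex y yX) => ey; subst y.
- by rewrite da in ndy.
- by rewrite k1y in k1b.
- by rewrite adj_refl in ndy.
- by rewrite adj_sym c2d in ndy.
Qed.

Lemma two_tops_dominated : #|S0| = 2 -> #|X S1| <= 4 -> ~ dominated S.
Proof.
move=> S2 X4 [d dC dX].
have [k1 [k2 [a [b [SE [ak1 k2a] [bk2 k1b]]]]]] := two_tops_split S2.
have SE' : S0 = [set k2; k1] by rewrite SE setUC.
have dX1 : d \in X S1.
  case: (in_core_or_corner dC) => //; rewrite -/S1 -/S0 SE => /set2P[] ed; subst d.
    by case: (dominator_corners_none dX ak1).
  by case: (dominator_corners_none dX bk2).
have [k] := corners_core dX1; rewrite -/S0 SE => /set2P[] -> dk; move: X4; rewrite leqNgt.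
  by rewrite (two_tops_aux SE ak1 k2a bk2 k1b dX1 dX dk).
by rewrite (two_tops_aux SE' bk2 k1b ak1 k2a dX1 dX dk).
Qed.

End NoApex.

(** Since [b] misses [a] and [c], its private neighbour [ub] sees only [b]. Together with [ua], a
    private neighbour of [a], it exhausts [X (core S)], and [end_and_pair_dominated] applies once
    [ua] sees at most [a] and [c]. *)
Lemma two_tops_triple_aux S k1 k2 a b c :
  let S1 := core (core S) in
  {in core S1 &, forall x y, adj x y} ->
  core S1 = [set k1; k2] -> #|X S1| = 3 -> #|X (core S)| = 2 ->
  corners S1 a k1 -> ~~ adj k2 a -> corners S1 b k2 -> ~~ adj k1 b ->
  c \in X S1 -> c != a -> c != b -> corners S1 c k1 -> ~ dominated S.
Proof.
move=> S1 cl SE X3 X2 ak1 k2a bk2 k1b cX ca cb ck1.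
have aX := corners_strict ak1; have bX := corners_strict bk2.
have aC := strict_corners_sub aX; have bC := strict_corners_sub bX.
have cC := strict_corners_sub cX.
have sub_k h k y : corners S1 h k -> y \in S1 -> adj h y -> adj k y.
  by case=> _ _ sub _; apply: sub.
have nab : ~~ adj a b by apply: contra k1b; apply: sub_k ak1 _.
have ncb : ~~ adj c b by apply: contra k1b; apply: sub_k ck1 _.
have ab : a != b by apply: contraNneq nab => ->.
have ex y : y \in X S1 -> [\/ y = a, y = b | y = c].
  by apply: card_exhaust3; rewrite ?X3 // eq_sym.
have inS1 y : y \in S1 -> [\/ y = k1, y = k2 | y \in X S1].
  case/in_core_or_corner; last by constructor 3.
  by rewrite SE => /set2P[]; [constructor 1 | constructor 2].
have [ua [uaX aua k1ua]] := corners_private ak1.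
have [ub [ubX bub k2ub]] := corners_private bk2.
have [wa waC uawa] := corners_core uaX; have [wb wbC ubwb] := corners_core ubX.
have uaS : ua \in core S := strict_corners_sub uaX.
have ubS : ub \in core S := strict_corners_sub ubX.
have sub_w u w y : corners (core S) u w -> y \in S1 -> adj u y -> adj w y.
  by case=> _ _ sub _ yC; apply: sub; apply: core_sub.
have waa : adj wa a by apply: (sub_w _ _ _ uawa) => //; rewrite adj_sym.
have wbb : adj wb b by apply: (sub_w _ _ _ ubwb) => //; rewrite adj_sym.
have ewb : wb = b.
  case: (inS1 wb wbC) => [e|e|/ex[]e//].
  - by rewrite e (negbTE k1b) in wbb.
  - by case/negP: k2ub; rewrite -e (corners_adj ubwb).
  - by rewrite e (negbTE nab) in wbb.
  - by rewrite e (negbTE ncb) in wbb.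
subst wb; have ubE y : y \in S1 -> adj ub y -> y = b.
  move=> yC uy; have ay := sub_w _ _ _ ubwb yC uy.
  case: (inS1 y yC) => [e|e|/ex[]e//].
  - by rewrite e adj_sym (negbTE k1b) in ay.
  - by case/negP: k2ub; rewrite -e adj_sym.
  - by rewrite e adj_sym (negbTE nab) in ay.
  - by rewrite e adj_sym (negbTE ncb) in ay.
have ewa : wa = a \/ wa = c.
  case: (inS1 wa waC) => [e|e|/ex[]e]; auto.
  - by case/negP: k1ua; rewrite -e (corners_adj uawa).
  - by rewrite e (negbTE k2a) in waa.
  - by rewrite e adj_sym (negbTE nab) in waa.
have uab : ua != ub.
  by apply: contraNneq nab => e; rewrite -(ubE a) ?adj_refl // -e adj_sym.
have ex2 := card_exhaust2 uaX ubX uab (eq_leq X2).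
have XE : X (core S) = [set ua; ub].
  apply/setP => x; rewrite in_set2; apply/idP/orP => [|[] /eqP-> //].
  by case/ex2 => ->; rewrite eqxx; auto.
(* If [c] is adjacent to [k2], it misses [a], as it would otherwise see all that [k1] sees; then
   neither [ua] nor [ub] can serve as its private neighbour. *)
case: (boolP (adj c k2)) => [ck2|nck2].
  exfalso.
  have k2c : adj k2 c by rewrite adj_sym.
  have nca : ~~ adj c a.
    apply/negP => aca; case: (ck1) => _ _ _ [y [yC k1y ncy]].
    case: (inS1 y yC) => [e|e|/ex[]e]; subst y.
    - by rewrite adj_sym (corners_adj ck1) in ncy.
    - by rewrite ck2 in ncy.
    - by rewrite aca in ncy.
    - by rewrite k1y in k1b.
    - by rewrite adj_refl in ncy.
  have {}ewa : wa = a by case: ewa => // e; rewrite e (negbTE nca) in waa.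
  have [u [uX cu _]] := corners_private ck1.
  case: (ex2 u uX) => e; subst u.
    by case/negP: nca; rewrite adj_sym -ewa; apply: (sub_w _ _ _ uawa); rewrite // adj_sym.
  by move: cb; rewrite (ubE c) ?eqxx // adj_sym.
apply: (end_and_pair_dominated XE (a1 := a) (a2 := c) (b := b)).
- by move=> e; rewrite e eqxx in ab.
- by move=> e; rewrite e eqxx in cb.
- move=> y yC uy; have wy := sub_w _ _ _ uawa yC uy.
  case: (inS1 y yC) => [e|e|/ex[]e]; auto.
  + by case/negP: k1ua; rewrite -e adj_sym.
  + by case: ewa wy => ->; rewrite e ?(negbTE nck2) // adj_sym (negbTE k2a).
  + by case: ewa wy => ->; rewrite e ?(negbTE nab) ?(negbTE ncb).
- exact: ubE.
Qed.

Lemma two_tops_triple_pair_dominated S :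
  let S1 := core (core S) in
  {in core S1 &, forall x y, adj x y} ->
  {in core S1, forall k, ~~ dominates adj k S1} ->
  #|core S1| = 2 -> #|X S1| = 3 -> #|X (core S)| = 2 -> ~ dominated S.
Proof.
move=> S1 cl nd S2 X3 X2.
have [k1 [k2 [a [b [SE [ak1 k2a] [bk2 k1b]]]]]] := two_tops_split cl nd S2.
have SE' : core S1 = [set k2; k1] by rewrite SE setUC.
have [c [cX ca cb]] : exists c, [/\ c \in X S1, c != a & c != b].
  case: (pickP [pred h in X S1 | (h != a) && (h != b)]) => [c /and3P[]|no]; first by exists c.
  have sub : X S1 \subset [set a; b].
    apply/subsetP => x xX; have /= := no x; rewrite in_set2 xX /=.
    by case: eqP => //= _ /negbFE.
  by have := subset_leq_card sub; rewrite X3 cards2; case: (a != b).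
have [k] := corners_core cX; rewrite SE => /set2P[] -> ck.
  exact: (two_tops_triple_aux cl SE X3 X2 ak1 k2a bk2 k1b cX ca cb ck).
exact: (two_tops_triple_aux cl SE' X3 X2 bk2 k1b ak1 k2a cX cb ca ck).
Qed.

(** ** Rank cardinality vectors *)

(** Entries are numbered from the top, [x0] being the size of the clique. Two ends at the level of
    [x2] exclude a lone corner one level lower, and further down while the levels between have few
    strict corners. *)
Definition two_ended_cards x2 x3 x4 x5 :=
  [/\ x3 <> 1, x2 <= 3 -> x4 <> 1 & x2 = 2 -> x3 <= 3 -> x5 <> 1].

Section Levels.
Variable S : {set T}.
Let S4 := core S. Let S3 := core S4. Let S2 := core S3.
Let S1 := core S2. Let S0 := core S1.
Let x0 := #|S0|. Let x1 := #|X S1|. Let x2 := #|X S2|.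
Let x3 := #|X S3|. Let x4 := #|X S4|. Let x5 := #|X S|.

Lemma two_ends_cards : two_ends S2 ->
  two_ended_cards x2 x3 x4 x5.
Proof.
move=> te; split=> [/lone_corner_dominated|l2 /lone_corner_dominated|e2 l3 /lone_corner_dominated].
- exact: two_ends_dominated.
- exact: two_ends_core_dominated.
- by apply: two_ends_core_dominated => //; apply: two_ends_core.
Qed.

Hypothesis cl : is_clique adj S0.

Lemma clique_level_cards : ~~ is_clique adj S1 -> 0 < x1 -> x1 <> 1 /\ x2 <> 1.
Proof.
move=> nc x1p; split; first exact: card1_under_clique.
by apply: card1_two_under_clique; rewrite // -card_gt0.
Qed.

Lemma apex_level_cards : x0 = 1 ->
  [/\ x1 = 2 -> two_ended_cards x2 x3 x4 x5,
      x1 = 3 -> x3 <> 1 & x1 = 3 -> x2 = 2 -> x4 <> 1].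
Proof.
move=> /eqP/cards1P[v SE]; split=> [e1|e1 /lone_corner_dominated|e1 e2 /lone_corner_dominated].
- by apply: two_ends_cards; apply: apex_pair_two_ends SE e1.
- exact: apex_triple_dominated SE e1.
- exact: apex_triple_pair_dominated SE e1 e2.
Qed.

Lemma no_apex_level_cards : {in S0, forall k, ~~ dominates adj k S1} ->
  [/\ x0 <> 1, x0 = 2 -> x1 <= 4 -> x3 <> 1, x0 <= 4 -> x1 = 2 -> x3 <> 1,
      x0 = 2 -> x1 = 3 -> x2 = 2 -> x4 <> 1
    & x1 = 2 -> x0 <= 2 \/ x0 <= 3 /\ x2 <= 2 -> two_ended_cards x2 x3 x4 x5].
Proof.
move=> nd; have /is_cliqueP clS := cl.
split=> [/eqP/cards1P[v SE]|e0 l1 /lone_corner_dominated|l0 e1 /lone_corner_dominated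
        |e0 e1 e2 /lone_corner_dominated|e1 l].
- by have := nd v; rewrite SE set11 => /(_ isT); case: (apex SE) => _ ->.
- exact: two_tops_dominated.
- exact: pair_dominated.
- exact: two_tops_triple_pair_dominated.
- by apply: two_ends_cards; apply: pair_two_ends.
Qed.

End Levels.

Lemma rank_card_vectorS k :
  rank_card_vector adj k.+1 = #|Xk adj k.+1| :: rank_card_vector adj k.
Proof.
have e : iota 1 k.+1 = rcons (iota 1 k) k.+1.
  by rewrite -(addn1 k) iotaD add1n addn1 cats1.
by rewrite /rank_card_vector e rev_rcons.
Qed.

Lemma size_rank_card_vector k : size (rank_card_vector adj k) = k.
Proof. by rewrite size_map size_rev size_iota. Qed.

Lemma XkE j : ~~ is_clique adj (G j) -> Xk adj j.+1 = X (G j).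
Proof. by rewrite /Xk /Gk /= => /negbTE->. Qed.

Lemma sumn_rank_card_vector_proper j : proper_upto j ->
  sumn (rank_card_vector adj j) + #|G j| = #|T|.
Proof.
elim: j => [|j IH] pj; first by rewrite /= cardsT.
rewrite -(IH (proper_uptoW pj)) rank_card_vectorS XkE ?GseqS ?pj //.
rewrite -[#|G j|](cardsID (X (G j))) (setIidPr _); last first.
  by apply/subsetP => v; apply: strict_corners_sub.
by rewrite [sumn _]/=; rewrite -/(core _); lia.
Qed.

Lemma sumn_rank_card_vector alpha : corner_rank adj alpha ->
  sumn (rank_card_vector adj alpha) = #|T|.
Proof.
move=> cr; have pa := corner_rank_proper cr; have Xa := Xk_top cr.
case: cr pa Xa => + _; case: alpha => // a _ pa Xa.
by rewrite rank_card_vectorS Xa /= addnC sumn_rank_card_vector_proper.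
Qed.

Lemma rank_card_vector_pos alpha (v0 : T) : corner_rank adj alpha ->
  all (leq 1) (rank_card_vector adj alpha).
Proof.
move=> cr; have pa := corner_rank_proper cr; have Xa := Xk_top cr.
case: cr pa Xa => + [_]; case: alpha => // a _ H pa Xa.
apply/allP => _ /mapP[k + ->]; rewrite mem_rev mem_iota card_gt0 => kr.
have [->|ka] := eqVneq k a.+1.
  by rewrite Xa; apply/set0Pn; apply: Gseq_neq0.
have [|nc nX] := H k; first by move: kr ka; lia.
by rewrite /Xk (negbTE nc).
Qed.

End Corners.

(** * Arithmetic of vectors of positive integers *)

Lemma all2_leq_sumn (s t : seq nat) : all2 leq s t -> sumn s <= sumn t.
Proof.
elim: s t => [|x s IH] [|y t] //= /andP[xy /IH]; exact: leq_add.
Qed.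

Lemma all2_leq_sumn_eq (s t : seq nat) : all2 leq s t -> sumn t = sumn s -> t = s.
Proof.
elim: s t => [|x s IH] [|y t] //= /andP[xy st] e.
by have := all2_leq_sumn st; move=> l; rewrite (IH t st); [congr cons|]; lia.
Qed.

Lemma all2_leq_sumnS (s t : seq nat) : all2 leq s t -> sumn t = (sumn s).+1 ->
  exists2 i, i < size s & t = incr_entry s i.
Proof.
elim: s t => [|x s IH] [|y t] //= /andP[xy st] e.
have l := all2_leq_sumn st; have [exy|nxy] := eqVneq y x.
  case: (IH t st) => [|i si ->]; first by lia.
  by exists i.+1; rewrite // /incr_entry exy.
exists 0 => //; rewrite /incr_entry /= (all2_leq_sumn_eq st); last by lia.
by congr cons; lia.
Qed.

Lemma all2_leq_nseq1 (s : seq nat) : all (leq 1) s -> all2 leq (nseq (size s) 1) s.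
Proof. by elim: s => //= x s IH /andP[-> /IH]. Qed.

Lemma all_leq1_sumn (s : seq nat) : all (leq 1) s ->
  size s <= sumn s /\ (sumn s = size s -> s = nseq (size s) 1).
Proof.
move=> /all2_leq_nseq1 al; have := all2_leq_sumn al; rewrite sumn_nseq mul1n => l.
by split=> // e; apply: all2_leq_sumn_eq al _; rewrite sumn_nseq mul1n.
Qed.

Lemma sumn_incr_entry s i : i < size s -> sumn (incr_entry s i) = (sumn s).+1.
Proof.
elim: s i => [|x s IH] [|i] //= si.
by have := IH i si; rewrite /incr_entry => ->; rewrite addnS.
Qed.

Lemma size_incr_entry s i : i < size s -> size (incr_entry s i) = size s.
Proof. by move=> si; rewrite /incr_entry size_set_nth; apply/maxn_idPr. Qed.

Lemma size_std_ext s m : size (std_ext s m) = size s + m.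
Proof. by rewrite size_cat size_nseq. Qed.

Lemma sumn_std_ext s m : sumn (std_ext s m) = sumn s + last 0 s * m.
Proof. by rewrite sumn_cat sumn_nseq. Qed.

(** The entries exceed 1 by 4 in total. If [x0] is 1, the exclusions force [x1 >= 4] and [x2 >= 2],
    which use up the excess. Otherwise the entries are at least 2, 2, 2, 1, ... and one unit remains
    to be placed. *)
Lemma type1_vector x0 x1 x2 x3 x4 x5 r (s := [:: x0, x1, x2, x3, x4, x5 & r]) :
  all (leq 1) s -> sumn s = size s + 4 -> x1 <> 1 -> x2 <> 1 ->
  (x0 = 1 -> [/\ x1 = 2 -> two_ended_cards x2 x3 x4 x5,
                 x1 = 3 -> x3 <> 1 & x1 = 3 -> x2 = 2 -> x4 <> 1]) ->
  (exists m, s = std_ext [:: 1; 4; 2; 1] m) \/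
  (exists m i, i < size (std_ext [:: 2; 2; 2; 1] m) /\
               s = incr_entry (std_ext [:: 2; 2; 2; 1] m) i).
Proof.
rewrite {}/s /= => /and5P[p0 p1 p2 p3 /and3P[p4 p5 pr]] sm n1 n2 H.
have [lr er] := all_leq1_sumn pr.
have [e0|n0] := eqVneq x0 1.
  left; have [H2 H3 H3'] := H e0.
  have e1 : x1 = 4.
    have [e1|n12] := eqVneq x1 2; first by have [] := H2 e1; lia.
    have [e1|n13] := eqVneq x1 3; first by have := H3 e1; have := H3' e1; lia.
    lia.
  (* The appended entries are [x4], [x5] and those of [r]. *)
  exists (size r).+2; rewrite e0 e1 er; last by lia.
  have -> : x2 = 2 by lia.
  have -> : x3 = 1 by lia.
  have -> : x4 = 1 by lia.
  have -> : x5 = 1 by lia.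
  by rewrite size_nseq.
right; exists (size r).+2.
have [||i si ei] := @all2_leq_sumnS (std_ext [:: 2; 2; 2; 1] (size r).+2)
  [:: x0, x1, x2, x3, x4, x5 & r]; [| |by exists i].
  by rewrite /= all2_leq_nseq1 // p3 p4 p5; lia.
by rewrite sumn_std_ext /=; lia.
Qed.

(** The excess is now 5, and [x0], [x1], [x2] are at least 2. The exclusions rule out the value 2
    for [x0] and for [x1], so 3, 3, 2 use up the excess. *)
Lemma type0_vector x0 x1 x2 x3 x4 x5 r (s := [:: x0, x1, x2, x3, x4, x5 & r]) :
  all (leq 1) s -> sumn s = size s + 5 -> x1 <> 1 -> x2 <> 1 ->
  [/\ x0 <> 1, x0 = 2 -> x1 <= 4 -> x3 <> 1, x0 <= 4 -> x1 = 2 -> x3 <> 1,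
      x0 = 2 -> x1 = 3 -> x2 = 2 -> x4 <> 1
    & x1 = 2 -> x0 <= 2 \/ x0 <= 3 /\ x2 <= 2 -> two_ended_cards x2 x3 x4 x5] ->
  exists m, s = std_ext [:: 3; 3; 2; 1] m.
Proof.
rewrite {}/s /= => /and5P[p0 p1 p2 p3 /and3P[p4 p5 pr]] sm n1 n2 [n0 H24 H42 H232 HQ].
have [lr er] := all_leq1_sumn pr.
have [e0 [e1 e2]] : x0 = 3 /\ x1 = 3 /\ x2 = 2.
  have [e1|n12] := eqVneq x1 2; last by lia.
  have [l|l] := leqP x0 2; first by have [] := HQ e1 (or_introl l); lia.
  have [l2|l2] := leqP x2 2; last by lia.
  have [l3|l3] := leqP x0 3; last by lia.
  by have [] := HQ e1 (or_intror (conj l3 l2)); lia.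
exists (size r).+2; rewrite e0 e1 e2 er; last by lia.
have -> : x3 = 1 by lia.
have -> : x4 = 1 by lia.
have -> : x5 = 1 by lia.
by rewrite size_nseq.
Qed.

(** * From capture time to rank cardinality vectors and back *)

Section CaptureTime.
Variables (T : finType) (adj : rel T).
Hypotheses (adj_refl : reflexive adj) (adj_sym : symmetric adj).

Lemma realizes_capture_time r vec : realizes adj r vec -> 3 <= size vec ->
  capture_time adj (size vec - r) /\ sumn vec = #|T|.
Proof.
move=> [_ [r1 [alpha [cr a2 tp <-]]]]; rewrite size_rank_card_vector => a3.
rewrite sumn_rank_card_vector //; split=> //.
have [v0 _] : exists v, v \in Gseq adj 0.
  case: cr a3 => _ [_ H] a3; have [|_ /set0Pn[v vX]] := H 1; first by lia.
  by exists v; rewrite inE.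
have -> : r = [exists v in Xk adj alpha, dominates adj v (Gk adj alpha.-1)].
  by rewrite -tp; case: r r1 {tp} => [|[]].
exact: capture_time_rank.
Qed.

Lemma corner_rank_levels b : corner_rank adj b.+2.+4 ->
  let S := Gseq adj b in
  let S4 := core adj S in let S3 := core adj S4 in let S2 := core adj S3 in
  let S1 := core adj S2 in let S0 := core adj S1 in
  [/\ rank_card_vector adj b.+2.+4 =
        [:: #|S0|, #|strict_corners adj S1|, #|strict_corners adj S2|,
            #|strict_corners adj S3|, #|strict_corners adj S4|, #|strict_corners adj S|
          & rank_card_vector adj b],
      is_clique adj S0, ~~ is_clique adj S1,
      Gk adj b.+2.+4 = S0 & Gk adj b.+1.+4 = S1].
Proof.
move=> cr; have pa := corner_rank_proper cr; have Xa := Xk_top cr.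
have [_ [cl _]] := cr.
have nc i : i <= b.+4 -> ~~ is_clique adj (Gseq adj i) by apply: pa.
have ib : b <= b.+4 by lia.
have ib1 : b.+1 <= b.+4 by lia.
have ib2 : b.+2 <= b.+4 by lia.
have ib3 : b.+3 <= b.+4 by lia.
move=> S S4 S3 S2 S1 S0.
have e4 : Gseq adj b.+1 = S4 by rewrite GseqS ?nc.
have e3 : Gseq adj b.+2 = S3 by rewrite GseqS ?nc // e4.
have e2 : Gseq adj b.+3 = S2 by rewrite GseqS ?nc // e3.
have e1 : Gseq adj b.+4 = S1 by rewrite GseqS ?nc // e2.
have e0 : Gseq adj b.+1.+4 = S0 by rewrite GseqS ?nc // e1.
have ex j : j <= b.+4 -> Xk adj j.+1 = strict_corners adj (Gseq adj j).
  by move=> /nc; apply: XkE.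
split.
- by rewrite !rank_card_vectorS Xa /Gk succnK e0 (ex _ (leqnn _)) e1 (ex _ ib3) e2
    (ex _ ib2) e3 (ex _ ib1) e4 (ex _ ib).
- by rewrite -e0.
- by rewrite -e1 nc.
- exact: e0.
- exact: e1.
Qed.

Lemma capture_time_vectors (t := #|T| - 5) : 11 <= #|T| -> cop_win adj ->
  capture_time adj t ->
  [\/ exists m, realizes adj 1 (std_ext [:: 1; 4; 2; 1] m),
      exists m i, i < size (std_ext [:: 2; 2; 2; 1] m) /\
                  realizes adj 1 (incr_entry (std_ext [:: 2; 2; 2; 1] m) i)
    | exists m, realizes adj 0 (std_ext [:: 3; 3; 2; 1] m)].
Proof.
move=> hn hcw ct.
have [v0 _] : exists v0 : T, v0 \in [set: T] by apply/set0Pn; rewrite -card_gt0 cardsT; lia.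
have [alpha cr] := cop_win_corner_rank adj_refl adj_sym v0 hcw.
have lt : t <= alpha.
  by rewrite leqNgt; apply/negP => /(proj2 ct); apply; apply: corner_rank_wins_within.
(* With at least 11 vertices [t] is at least 6, so the six top levels exist. *)
have a6 : 6 <= alpha by move: lt; rewrite /t; lia.
have et : t = alpha - [exists v in Xk adj alpha, dominates adj v (Gk adj alpha.-1)].
  by apply: capture_time_uniq ct _; apply: capture_time_rank => //; lia.
have sum := sumn_rank_card_vector cr.
have pos := rank_card_vector_pos v0 cr.
have [b eb] : exists b, alpha = b.+2.+4 by exists (alpha - 6); lia.
subst alpha; have [eV cl nc eG0 eG1] := corner_rank_levels cr.
have Xa := Xk_top cr; rewrite Xa /= eG0 eG1 in et.
have szV := size_rank_card_vector adj b.+2.+4.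
have x1p : 0 < #|strict_corners adj (core adj (core adj (core adj (core adj (Gseq adj b)))))|.
  by move: pos; rewrite eV /= => /andP[_ /andP[]].
have [n1 n2] := clique_level_cards adj_refl adj_sym cl nc x1p.
have real r : (r == 1) = [exists v in Gk adj b.+2.+4, dominates adj v (Gk adj b.+1.+4)] ->
    r <= 1 -> realizes adj r (rank_card_vector adj b.+2.+4).
  by move=> er r1; split=> //; split=> //; exists b.+2.+4; split=> //; rewrite Xa.
rewrite eG0 eG1 in real.
(* By type, [alpha] is [#|T| - 4] or [#|T| - 5], so the entries exceed 1 by 4 or 5 in total. *)
case: exists_inP et real => [ex|nex] et real.
  have sumV : sumn (rank_card_vector adj b.+2.+4) = size (rank_card_vector adj b.+2.+4) + 4.
    by rewrite sum szV; move: et lt; rewrite /t; lia.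
  move: pos sumV (real 1); rewrite {}eV => pos sumV {}real.
  case: (type1_vector pos sumV n1 n2) => [e0|[m e]|[m [i [si e]]]].
  - exact: (apex_level_cards adj_refl adj_sym e0).
  - by constructor 1; exists m; rewrite -e; apply: real.
  - by constructor 2; exists m, i; split=> //; rewrite -e; apply: real.
have sumV : sumn (rank_card_vector adj b.+2.+4) = size (rank_card_vector adj b.+2.+4) + 5.
  by rewrite sum szV; move: et lt; rewrite /t; lia.
move: pos sumV (real 0); rewrite {}eV => pos sumV {}real.
have [|m e] := type0_vector pos sumV n1 n2.
  apply: (no_apex_level_cards adj_refl adj_sym cl) => k kS; apply/negP => dom.
  by apply: nex; exists k.
by constructor 3; exists m; rewrite -e; apply: real.
Qed.

End CaptureTime.

Theorem theorem5p2 (T : finType) (adj : rel T)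
    (adj_refl : reflexive adj) (adj_sym : symmetric adj)
    (hn : 11 <= #|T|) (hcw : cop_win adj) :
  capture_time adj (#|T| - 5) <->
  [\/ exists m, realizes adj 1 (std_ext [:: 1; 4; 2; 1] m),
      exists m i, i < size (std_ext [:: 2; 2; 2; 1] m) /\
                  realizes adj 1 (incr_entry (std_ext [:: 2; 2; 2; 1] m) i)
    | exists m, realizes adj 0 (std_ext [:: 3; 3; 2; 1] m)].
Proof.
(* The sum of a realized vector is [#|T|] and its length minus the type is the capture time, so the
   converse only compares sums and lengths. *)
have large r vec k : realizes adj r vec -> 3 <= size vec ->
    sumn vec = k -> size vec - r = k - 5 -> capture_time adj (#|T| - 5).
  by move=> re sz <- e; have [ct <-] := realizes_capture_time adj_refl adj_sym re sz;
     rewrite -e.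
split; first exact: capture_time_vectors.
case=> [[m re]|[m [i [si re]]]|[m re]].
- by apply: (large _ _ _ re); rewrite ?size_std_ext ?sumn_std_ext //=; lia.
- apply: (large _ _ _ re); first by rewrite size_incr_entry // size_std_ext.
    by rewrite sumn_incr_entry.
  by rewrite size_incr_entry // size_std_ext sumn_std_ext /=; lia.
- by apply: (large _ _ _ re); rewrite ?size_std_ext ?sumn_std_ext //=; lia.
Qed.
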